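(* Let $A$ be an arbitrary $m$-ary free algebra (the free algebra of some variety of $m$-ary algebras) in the variables $x_1,x_2,\ldots,x_n$ over a field $k$ of characteristic zero. Then the left-symmetric algebra $\mathscr{L}(A)$ of derivations of $A$ is simple if and only if $\mathscr{L}(A)$ is isomorphic to the left-symmetric Witt algebra $\mathscr{L}_n$ or to the associative matrix algebra $M_n(k)$.
   Context: Let $m\ge 2$. An $m$-ary algebra over $k$ is a $k$-vector space with one $m$-ary multilinear operation $\langle\cdot,\ldots,\cdot\rangle$; a derivation is a $k$-linear map satisfying the Leibniz rule for this operation. If $m=2$ and the variety is a unitary variety (a variety of algebras with identity element), $A$ is assumed to contain an identity element $1$. Varieties are assumed nontrivial. For a column $F=(f_1,\ldots,f_n)'$ of elements of $A$, $D_F=f_1\partial_1+\cdots+f_n\partial_n$ denotes the unique derivation of $A$ with $D_F(x_i)=f_i$ for all $i$; in particular $a\partial_i$ is the derivation with $x_i\mapsto a$ and $x_j\mapsto 0$ for $j\ne i$. Every derivation of $A$ has a unique expression of this form. $\mathscr{L}(A)$ denotes the space $\mathrm{Der}_kA$ of all $k$-linear derivations of $A$ with the bilinear product determined by $(a\partial_i)\cdot(b\partial_j)=((a\partial_i)(b))\partial_j$ for $a,b\in A$; it is a left-symmetric algebra, i.e. satisfies $(xy)z-x(yz)=(yx)z-y(xz)$. The left-symmetric Witt algebra of index $n$ is $\mathscr{L}_n=\mathscr{L}(k[x_1,\ldots,x_n])$, the left-symmetric algebra of all derivations of the polynomial algebra $k[x_1,\ldots,x_n]$. *)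

(* Defs.v *)
From HB Require Import structures.
From mathcomp Require Import all_boot all_order all_algebra.
From mathcomp Require Import boolp classical_sets functions.
From mathcomp Require Import mpoly.

Set Implicit Arguments.
Unset Strict Implicit.
Unset Printing Implicit Defensive.

Import GRing.Theory.
Local Open Scope ring_scope.

(* An m-ary k-algebra.  When u = true the identity element is part of the
   signature; when u = false the field [one] has an empty domain. *)
Record malg (k : fieldType) (m : nat) (u : bool) := MAlg {
  carrier :> lmodType k;
  op : ('I_m -> carrier) -> carrier;
  op_multilinear : forall (i : 'I_m) (v : 'I_m -> carrier),
    linear (fun a : carrier => op [eta v with i |-> a]);
  one : u -> carrier;
  op_one : forall (h : u) (i : 'I_m) (a : carrier),
    op [eta fun=> one h with i |-> a] = a
}.
Arguments one {k m u} _ _.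

Definition hom (k : fieldType) m u (A B : malg k m u) (f : A -> B) : Prop :=
  [/\ linear f,
      forall v : 'I_m -> A, f (op v) = op (f \o v)
    & forall h : u, f (one A h) = one B h].

(* Formal expressions for nonassociative m-ary polynomials over k in countably
   many variables. *)
Inductive mterm (k : fieldType) (m : nat) (u : bool) : Type :=
  | TVar of nat
  | TZero
  | TAdd of mterm k m u & mterm k m u
  | TScale of k & mterm k m u
  | TOp of ('I_m -> mterm k m u)
  | TOne of u.

Fixpoint teval (k : fieldType) m u (A : malg k m u) (e : nat -> A)
    (t : mterm k m u) : A :=
  match t with
  | TVar i => e i
  | TZero => 0
  | TAdd s t => teval e s + teval e t
  | TScale c t => c *: teval e t
  | TOp ts => op (fun i => teval e (ts i))
  | TOne h => one A h
  end.

(* The variety defined by the identities t = 0 for t in Id. *)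
Definition in_variety (k : fieldType) m u (Id : set (mterm k m u))
    (A : malg k m u) : Prop :=
  forall t, Id t -> forall e : nat -> A, teval e t = 0.

Definition nontrivial_variety (k : fieldType) m u (Id : set (mterm k m u)) :
    Prop :=
  exists A : malg k m u, in_variety Id A /\ exists a : A, a != 0.

Definition free_in_variety (k : fieldType) m u (Id : set (mterm k m u))
    (A : malg k m u) n (x : 'I_n -> A) : Prop :=
  in_variety Id A /\
  forall B : malg k m u, in_variety Id B -> forall y : 'I_n -> B,
    (exists2 f : A -> B, hom f & forall i, f (x i) = y i) /\
    (forall f g : A -> B, hom f -> hom g ->
       (forall i, f (x i) = y i) -> (forall i, g (x i) = y i) -> f =1 g).

Section Derivations.
Variables (k : fieldType) (m : nat) (u : bool) (A : malg k m u).

Definition derivation (D : A -> A) : Prop :=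
  linear D /\
  forall v : 'I_m -> A, D (op v) = \sum_(i < m) op [eta v with i |-> D (v i)].

Definition derivation_pred : {pred A -> A} := fun D => `[< derivation D >].

Lemma derivation_submod : submod_closed derivation_pred.
Proof.
have opl i v : exists f : {linear A -> A}, forall a, f a = op [eta v with i |-> a].
  pose L := GRing.isLinear.Build k A A *:%R (fun a : A => op [eta v with i |-> a])
    (op_multilinear i v).
  pose f : {linear A -> A} := HB.pack (fun a : A => op [eta v with i |-> a]) L.
  by exists f.
split=> [|c D E /asboolP[lD hD] /asboolP[lE hE]]; apply/asboolP; split.
- by move=> a x y /=; rewrite scaler0 addr0.
- move=> v /=; rewrite big1 // => i _.
  by have [f fE] := opl i v; rewrite -fE linear0.
- move=> a x y; rewrite -[LHS]/(c *: D (a *: x + y) + E (a *: x + y)).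
  rewrite lD lE -[RHS]/(a *: (c *: D x + E x) + (c *: D y + E y)).
  by rewrite !scalerDr !scalerA mulrC addrACA.
- move=> v; rewrite -[LHS]/(c *: D (op v) + E (op v)) hD hE scaler_sumr.
  rewrite -big_split; apply: eq_bigr => i _ /=.
  have [f fE] := opl i v; rewrite -!fE -linearP; congr (f _).
Qed.

HB.instance Definition _ :=
  GRing.isSubmodClosed.Build k (A -> A) derivation_pred derivation_submod.

Record Der := MkDer { der_fun :> A -> A; _ : der_fun \in derivation_pred }.

HB.instance Definition _ := [isSub for der_fun].
HB.instance Definition _ := [Choice of Der by <:].
HB.instance Definition _ := [SubChoice_isSubLmodule of Der by <:].

Variables (n : nat) (x : 'I_n -> A).

(* The derivation D_F with D_F (x i) = F i for all i; it exists and is unique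
   when k is infinite and A is free on x in some variety. *)
Definition derF (F : 'I_n -> A) : Der :=
  xget 0 [set D : Der | forall i, D (x i) = F i].

Definition pder (a : A) (i : 'I_n) : Der := derF [eta fun=> 0 with i |-> a].

(* The product (a d_i) . (b d_j) = ((a d_i) b) d_j, extended bilinearly to
   D = \sum_i (D x_i) d_i and E = \sum_j (E x_j) d_j, where a d_i = pder a i. *)
Definition lsmul (D E : Der) : Der :=
  \sum_(i < n) \sum_(j < n) pder (pder (D (x i)) i (E (x j))) j.

End Derivations.

(* Below, a not necessarily associative algebra is a k-space L with a product
   mul; bilinearity of mul is not bundled. *)
Definition ideal (k : fieldType) (L : lmodType k) (mul : L -> L -> L)
    (I : set L) : Prop :=
  [/\ I 0,
      forall (c : k) a b, I a -> I b -> I (c *: a + b)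
    & forall a b, I a -> I (mul a b) /\ I (mul b a)].

Definition simple_alg (k : fieldType) (L : lmodType k) (mul : L -> L -> L) :
    Prop :=
  (exists a b, mul a b != 0) /\
  forall I : set L, ideal mul I -> I = [set 0]%classic \/ I = [set: L]%classic.

Definition isomorphic_alg (k : fieldType) (L1 L2 : lmodType k)
    (mul1 : L1 -> L1 -> L1) (mul2 : L2 -> L2 -> L2) : Prop :=
  exists f : L1 -> L2, [/\ linear f, bijective f
    & forall a b, f (mul1 a b) = mul2 (f a) (f b)].

Section PolynomialAlgebra.
Variables (k : fieldType) (n : nat).

Definition mpoly_op (v : 'I_2 -> {mpoly k[n]}) : {mpoly k[n]} :=
  v ord0 * v ord_max.

Lemma mpoly_op_multilinear (i : 'I_2) (v : 'I_2 -> {mpoly k[n]}) :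
  linear (fun a => mpoly_op [eta v with i |-> a]).
Proof.
move=> c a b; rewrite /mpoly_op /=.
case: i => [[|[|//]] lt2].
- rewrite (_ : Ordinal lt2 = ord0); last exact: val_inj.
  by rewrite mulrDl scalerAl.
- rewrite (_ : Ordinal lt2 = ord_max); last exact: val_inj.
  by rewrite mulrDr scalerAr.
Qed.

Lemma mpoly_op_one (h : true) (i : 'I_2) (a : {mpoly k[n]}) :
  mpoly_op [eta fun=> 1 with i |-> a] = a.
Proof.
rewrite /mpoly_op /=; case: i => [[|[|//]] lt2].
- rewrite (_ : Ordinal lt2 = ord0); last exact: val_inj.
  by rewrite mulr1.
- rewrite (_ : Ordinal lt2 = ord_max); last exact: val_inj.
  by rewrite mul1r.
Qed.

Definition mpoly_malg : malg k 2 true :=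
  MAlg mpoly_op_multilinear mpoly_op_one.

Definition mpoly_var (i : 'I_n) : mpoly_malg := 'X_i.

Definition witt_mul : Der mpoly_malg -> Der mpoly_malg -> Der mpoly_malg :=
  lsmul mpoly_var.

End PolynomialAlgebra.

(* Main.v *)
(* Take B to be k[x_1, ..., x_n] in the unitary case, and the n-dimensional
   algebra with zero product otherwise. In characteristic zero every nontrivial
   variety contains B, so there is an epimorphism phi : A -> B matching the
   generators. A derivation is determined by its values on the generators, and
   those may be prescribed freely both in A and in B; hence every derivation of
   A induces one on B, and {D | phi o D = 0} is a proper ideal for the product,
   which satisfies (D . E)(x_j) = D (E (x_j)). If L(A) is simple then this ideal
   is zero, which forces phi to be injective, and L(A) is isomorphic to L(B),
   which is the Witt algebra or the matrix algebra. Both of these are simple. *)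
Require Import Defs.
From HB Require Import structures.
From mathcomp Require Import all_boot all_order all_algebra.
From mathcomp Require Import boolp classical_sets functions.
From mathcomp Require Import mpoly.

Set Implicit Arguments.
Unset Strict Implicit.
Unset Printing Implicit Defensive.

(* Defs is imported again because mathcomp shadows its [hom] and [one]. *)
Import GRing.Theory Defs.
Local Open Scope ring_scope.

Local Notation upd v i a := (fun_of_simpl [eta v with i |-> a]).

(** Turns a bare linearity hypothesis into a bundled map, to which [linear0], [linearP] and
    [linear_sum] apply. *)
Lemma linear_bundle (k : fieldType) (U V : lmodType k) (f : U -> V) :
  linear f -> exists g : {linear U -> V}, f = g.
Proof.
move=> lf; pose L := GRing.isLinear.Build k U V *:%R f lf.
pose g : {linear U -> V} := HB.pack f L.
by exists g.
Qed.

Lemma eqr_nat_pchar0 (k : fieldType) : [pchar k] =i pred0 ->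
  forall i j, (i%:R == j%:R :> k) = (i == j).
Proof.
move=> /pcharf0P char0 i j; wlog leij : i j / (i <= j)%N => [IH|].
  case/orP: (leq_total i j) => le; first exact: IH.
  by rewrite eq_sym IH // eq_sym.
by rewrite eq_sym -subr_eq0 -natrB // char0 subn_eq0 eqn_leq leij.
Qed.

(** * Polynomial functions of one scalar and their first-order jets *)

Section Jets.
Variables (k : fieldType) (V : lmodType k).
Hypothesis char0 : [pchar k] =i pred0.

(** Horner form: an induction peels off the constant coefficient and leaves a factor [l]. *)
Inductive polyfun : (k -> V) -> Prop :=
  | PolyfunC a : polyfun (fun=> a)
  | PolyfunX a f : polyfun f -> polyfun (fun l => a + l *: f l).

(** A formal Taylor expansion at 0, with value [a] and derivative [b]. The remainder has to be
    polynomial; an arbitrary [g] would not determine [b]. *)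
Definition jet (f : k -> V) (a b : V) : Prop :=
  exists2 g, polyfun g & forall l, f l = a + l *: b + l ^+ 2 *: g l.

Lemma polyfun_ext f g : f =1 g -> polyfun f -> polyfun g.
Proof. by move=> /funext->. Qed.

Lemma polyfunD f g : polyfun f -> polyfun g -> polyfun (fun l => f l + g l).
Proof.
move=> pf; elim: pf g => [a|a {}f pf IH] g [b|b {}g pg].
- exact: PolyfunC.
- rewrite (_ : (fun l => _) = fun l => (a + b) + l *: g l); first exact: PolyfunX.
  by apply: funext => l; rewrite addrA.
- rewrite (_ : (fun l => _) = fun l => (a + b) + l *: f l); first exact: PolyfunX.
  by apply: funext => l; rewrite addrAC.
- rewrite (_ : (fun l => _) = fun l => (a + b) + l *: (f l + g l)).
    by apply: PolyfunX; apply: IH.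
  by apply: funext => l; rewrite scalerDr addrACA.
Qed.

Lemma polyfunZ c f : polyfun f -> polyfun (fun l => c *: f l).
Proof.
elim=> [a|a {}f pf IH]; first exact: PolyfunC.
rewrite (_ : (fun l => _) = fun l => c *: a + l *: (c *: f l)).
  exact: PolyfunX.
by apply: funext => l; rewrite scalerDr !scalerA mulrC.
Qed.

Lemma polyfunM f : polyfun f -> polyfun (fun l => l *: f l).
Proof.
move=> /(PolyfunX 0); rewrite (_ : (fun l => 0 + _) = fun l => l *: f l) //.
by apply: funext => l; rewrite add0r.
Qed.

Lemma polyfun_sum_pow f : polyfun f ->
  exists N (v : nat -> V), forall l, f l = \sum_(d < N.+1) l ^+ d *: v d.
Proof.
elim=> [a|a {}f pf [N [v fE]]].
  by exists 0, (fun=> a) => l; rewrite big_ord1 expr0 scale1r.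
exists N.+1, (fun d => if d is d'.+1 then v d' else a) => l.
rewrite big_ord_recl expr0 scale1r fE scaler_sumr; congr (_ + _).
by apply: eq_bigr => i _; rewrite scalerA -exprS.
Qed.

(* Replacing [l] by [2 l] and subtracting [2 ^ N] times the original identity
   kills the top coefficient. *)
Lemma sum_pow_eq0 N (v : nat -> V) :
  (forall l : k, l != 0 -> \sum_(d < N) l ^+ d *: v d = 0) ->
  forall d, (d < N)%N -> v d = 0.
Proof.
have nz n : (n.+1%:R == 0 :> k) = false by rewrite (pcharf0P _).1.
elim: N v => // N IH v v0.
have low d : (d < N)%N -> v d = 0.
  move=> ltdN; suff : (2%:R ^+ d - 2%:R ^+ N) *: v d = 0.
    move/eqP; rewrite scaler_eq0 subr_eq0 => /orP[|/eqP//].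
    by rewrite -!natrX eqr_nat_pchar0 // eqn_exp2l // (ltn_eqF ltdN).
  apply: (IH (fun d => (2%:R ^+ d - 2%:R ^+ N) *: v d)) => // l l0.
  have l20 : 2%:R * l != 0 by rewrite mulf_neq0 ?nz.
  have := congr2 (fun a b => a - 2%:R ^+ N *: b) (v0 _ l20) (v0 _ l0).
  rewrite /= !big_ord_recr /= scalerDr scalerA -exprMn opprD addrACA subrr addr0.
  rewrite scaler0 subr0 scaler_sumr -sumrB => e; rewrite -[RHS]e; apply: eq_bigr => i _.
  rewrite !scalerA -scalerBl; congr (_ *: _).
  by rewrite mulrBr exprMn; congr (_ - _); rewrite mulrC.
move=> d; rewrite ltnS leq_eqVlt => /orP[/eqP->|]; last exact: low.
have := v0 1 (oner_neq0 _); rewrite big_ord_recr /= expr1n scale1r big1 ?add0r //.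
by move=> i _; rewrite low // scaler0.
Qed.

(** All coefficients vanish by [sum_pow_eq0]. This allows a factor [l] to be cancelled from a
    polynomial identity, including at [l = 0]. *)
Lemma polyfun_at0 f : polyfun f -> (forall l, l != 0 -> f l = 0) -> f 0 = 0.
Proof.
move=> /polyfun_sum_pow[N [v fE]] f0.
rewrite fE big1 // => d _; rewrite (@sum_pow_eq0 N.+1 v) ?scaler0 // => l l0.
by rewrite -fE f0.
Qed.

Lemma jet_polyfun f a b : jet f a b -> polyfun f.
Proof.
case=> g pg fE.
rewrite (_ : f = fun l => a + l *: (b + l *: g l)); first by do 2!apply: PolyfunX.
by apply: funext => l; rewrite fE scalerDr scalerA addrA.
Qed.

Lemma jet_at0 f a b : jet f a b -> f 0 = a.
Proof. by case=> g _ ->; rewrite expr2 mulr0 !scale0r !addr0. Qed.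

(** The value at 0 gives [a = 0]. For [l != 0] a factor [l] cancels and leaves [b + l *: g l = 0],
    which [polyfun_at0] extends to [l = 0]. *)
Lemma jet0_inj f a b : jet f a b -> (forall l, f l = 0) -> a = 0 /\ b = 0.
Proof.
move=> jf f0; have a0 : a = 0 by rewrite -(jet_at0 jf).
split=> //; case: jf => g pg fE.
have := @polyfun_at0 _ (PolyfunX b pg); rewrite scale0r addr0; apply=> l l0.
have := fE l; rewrite f0 a0 add0r expr2 -scalerA -scalerDr => /esym/eqP.
by rewrite scaler_eq0 (negbTE l0) => /eqP.
Qed.

Lemma jet_ext f g a b : f =1 g -> jet f a b -> jet g a b.
Proof. by move=> /funext->. Qed.

Lemma jetC a : jet (fun=> a) a 0.
Proof.
by exists (fun=> 0) => [|l]; [exact: PolyfunC | rewrite !scaler0 !addr0].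
Qed.

Lemma jetD f g a b c d :
  jet f a b -> jet g c d -> jet (fun l => f l + g l) (a + c) (b + d).
Proof.
move=> [f2 pf fE] [g2 pg gE]; exists (fun l => f2 l + g2 l); first exact: polyfunD.
by move=> l; rewrite fE gE !scalerDr addrACA (addrACA a).
Qed.

Lemma jetZ c f a b : jet f a b -> jet (fun l => c *: f l) (c *: a) (c *: b).
Proof.
move=> [g pg fE]; exists (fun l => c *: g l); first exact: polyfunZ.
by move=> l; rewrite fE !scalerDr !scalerA !(mulrC c).
Qed.

Lemma jetX f a b : jet f a b -> jet (fun l => l *: f l) 0 a.
Proof.
case=> g pg fE; exists (fun l => b + l *: g l); first exact: PolyfunX.
by move=> l; rewrite fE add0r !scalerDr !scalerA -expr2 -exprS -exprSr addrA.
Qed.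

Lemma jetX2 f : polyfun f -> jet (fun l => l ^+ 2 *: f l) 0 0.
Proof. by exists f => // l; rewrite scaler0 !add0r. Qed.

Lemma jet_inj f a b c d : jet f a b -> jet f c d -> a = c /\ b = d.
Proof.
move=> j1 /(jetZ (-1)) j2; have [] := jet0_inj (jetD j1 j2).
  by move=> l; rewrite scaleN1r subrr.
by rewrite !scaleN1r => /eqP; rewrite subr_eq0 => /eqP-> /eqP; rewrite subr_eq0 => /eqP->.
Qed.

End Jets.

(** * Multilinear operations applied to polynomial functions and jets *)

Section Op.
Variables (k : fieldType) (m : nat) (u : bool) (A : malg k m u).

Lemma upd_id (T : Type) (v : 'I_m -> T) i : upd v i (v i) = v.
Proof. by apply: funext => j /=; case: eqP => [->|]. Qed.

Lemma updC (T : Type) (v : 'I_m -> T) i j a b : i != j ->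
  upd (upd v i a) j b = upd (upd v j b) i a.
Proof.
by move=> ij; apply: funext => l /=; case: (l =P i) => [->|//]; rewrite (negbTE ij).
Qed.

Lemma comp_upd (T U : Type) (f : T -> U) (v : 'I_m -> T) i a :
  f \o upd v i a = upd (f \o v) i (f a).
Proof. by apply: funext => j /=; case: eqP. Qed.

Lemma op_updD (v : 'I_m -> A) i a b :
  op (upd v i (a + b)) = op (upd v i a) + op (upd v i b).
Proof. by have := op_multilinear i v 1 a b; rewrite !scale1r. Qed.

Lemma op_upd0 (v : 'I_m -> A) i : op (upd v i 0) = 0.
Proof.
have := op_updD v i 0 0; rewrite addr0 => /eqP.
by rewrite -subr_eq0 opprD addrA subrr sub0r oppr_eq0 => /eqP.
Qed.

Lemma op_updZ (v : 'I_m -> A) i c a : op (upd v i (c *: a)) = c *: op (upd v i a).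
Proof. by have := op_multilinear i v c a 0; rewrite !addr0 op_upd0 addr0. Qed.

Lemma polyfun_op (f : 'I_m -> k -> A) :
  (forall i, polyfun (f i)) -> polyfun (fun l => op (f^~ l)).
Proof.
(* Induction on a list [s] of the places whose argument may depend on [l]. *)
suff gen (s : seq 'I_m) : forall g : 'I_m -> k -> A, (forall i, polyfun (g i)) ->
    (forall i, i \notin s -> exists a, g i = fun=> a) -> polyfun (fun l => op (g^~ l)).
  by move=> pf; apply: (gen (enum 'I_m)) => // i; rewrite mem_enum.
elim: s => [|i s IH] g pg gc.
  have /choice[a ga] : forall i, exists a, g i = fun=> a by move=> i; apply: gc.
  rewrite (_ : (fun l => _) = fun=> op a); first exact: PolyfunC.
  by apply: funext => l; congr op; apply: funext => i; rewrite ga.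
have const a : polyfun (fun l => op (upd (g^~ l) i a)).
  apply: (@polyfun_ext k A (fun l => op ((upd g i (fun=> a))^~ l))) => [l|].
    by congr op; apply: funext => j /=; case: eqP.
  apply: IH => j /=; case: eqP => [_|/eqP ji]; [exact: PolyfunC|exact: pg|by exists a|].
  by move=> js; apply: gc; rewrite inE negb_or ji.
(* Only place [i] is now expanded, by induction on the Horner form of its argument. *)
suff key h : polyfun h -> polyfun (fun l => op (upd (g^~ l) i (h l))).
  by apply: polyfun_ext (key _ (pg i)) => l; rewrite (upd_id (g^~ l)).
elim=> // a {}h ph IHh; apply: polyfun_ext (polyfunD (const a) (polyfunM IHh)) => l.
by rewrite op_updD op_updZ.
Qed.

(** The product rule for a multilinear operation, proved by letting one more argument vary at a
    time. *)
Lemma jet_op (f : 'I_m -> k -> A) (a b : 'I_m -> A) :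
  (forall i, jet (f i) (a i) (b i)) ->
  jet (fun l => op (f^~ l)) (op a) (\sum_(i < m) op (upd a i (b i))).
Proof.
suff gen (s : seq 'I_m) : forall g c d, (forall i : 'I_m, jet (g i) (c i) (d i)) ->
    (forall i, i \notin s -> g i = (fun=> c i) /\ d i = 0 :> A) ->
    jet (fun l => op (g^~ l)) (op c) (\sum_(i < m) op (upd c i (d i))).
  by move=> jf; apply: (gen (enum 'I_m)) => // i; rewrite mem_enum.
elim: s => [|i s IH] g c d jg gc.
  rewrite big1 => [|i _]; last by have [//|_ ->] := gc i; rewrite op_upd0.
  apply: (@jet_ext k A (fun=> op c)) => [l|]; last exact: jetC.
  by congr op; apply: funext => i; have [//|->] := gc i.
have [h ph gE] := jg i.
(* With place [i] frozen at [e] the derivative there is 0, so the induction hypothesis leaves the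
   sum over the other places. *)
have IHi e : jet (fun l => op (upd (g^~ l) i e)) (op (upd c i e))
               (\sum_(j < m | j != i) op (upd (upd c i e) j (d j))).
  have -> : \sum_(j < m | j != i) op (upd (upd c i e) j (d j))
      = \sum_(j < m) op (upd (upd c i e) j (upd d i 0 j)).
    rewrite [RHS](bigD1 i) //= eqxx op_upd0 add0r; apply: eq_bigr => j.
    by move=> /negbTE ji; rewrite /= ji.
  apply: (@jet_ext k A (fun l => op ((upd g i (fun=> e))^~ l))) => [l|].
    by congr op; apply: funext => j /=; case: eqP.
  apply: IH => j /=; case: eqP => [_|/eqP ji]; [exact: jetC|exact: jg|by []|].
  by move=> js; apply: gc; rewrite inE negb_or ji.
have ph2 : polyfun (fun l => op (upd (g^~ l) i (h l))).
  apply: (@polyfun_ext k A (fun l => op ((upd g i h)^~ l))) => [l|].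
    by congr op; apply: funext => j /=; case: eqP.
  by apply: polyfun_op => j /=; case: eqP => // _; exact: jet_polyfun (jg j).
(* Splitting argument [i] as [c i + l *: d i + l ^+ 2 *: h l] gives three terms. The second
   contributes the missing summand of the derivative, and the third has zero jet. *)
have := jetD (jetD (IHi (c i)) (jetX (IHi (d i)))) (jetX2 ph2).
rewrite !addr0 (upd_id c) [X in _ -> jet _ _ X](bigD1 i) //= [X in _ -> jet _ _ X]addrC.
apply: jet_ext => l.
by rewrite -!op_updZ -!op_updD -gE (upd_id (g^~ l)).
Qed.

End Op.

(** * Subalgebras, generation, and free algebras *)

Section Subalgebra.
Variables (k : fieldType) (m : nat) (u : bool).
Implicit Types A B : malg k m u.

Definition subalgebra A (P : A -> Prop) : Prop :=
  [/\ P 0, forall (c : k) a b, P a -> P b -> P (c *: a + b),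
      forall v : 'I_m -> A, (forall i, P (v i)) -> P (op v)
    & forall h, P (one A h)].

(** Stated as an induction principle, so that it can be applied directly to a goal about all
    elements. *)
Definition generates A n (x : 'I_n -> A) : Prop :=
  forall P, subalgebra P -> (forall i, P (x i)) -> forall a, P a.

Section SubalgebraMalg.
Variables (A : malg k m u) (P : A -> Prop) (sP : subalgebra P).

(** The closure proof is an argument so that the submodule instance below can be attached to the
    predicate. *)
Definition sub_pred of subalgebra P : {pred A} := fun a => `[< P a >].

Lemma sub_pred_submod : submod_closed (sub_pred sP).
Proof.
have [P0 PD _ _] := sP; split; first exact/asboolP.
by move=> c a b /asboolP Pa /asboolP Pb; apply/asboolP/PD.
Qed.

HB.instance Definition _ :=
  GRing.isSubmodClosed.Build k A (sub_pred sP) sub_pred_submod.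

Record sub_carrier := MkSub { sub_val :> A; _ : sub_val \in sub_pred sP }.

HB.instance Definition _ := [isSub for sub_val].
HB.instance Definition _ := [Choice of sub_carrier by <:].
HB.instance Definition _ := [SubChoice_isSubLmodule of sub_carrier by <:].

Lemma sub_valP (a : sub_carrier) : P a.
Proof. by case: a => a /= /asboolP. Qed.

Lemma sub_op_mem (v : 'I_m -> sub_carrier) : op (sub_val \o v) \in sub_pred sP.
Proof. by have [_ _ Pop _] := sP; apply/asboolP/Pop => i; apply: sub_valP. Qed.

Lemma sub_one_mem (h : u) : one A h \in sub_pred sP.
Proof. by have [_ _ _ Pone] := sP; apply/asboolP/Pone. Qed.

Definition sub_op v : sub_carrier := MkSub (sub_op_mem v).
Definition sub_one h : sub_carrier := MkSub (sub_one_mem h).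

Lemma sub_op_multilinear (i : 'I_m) v : linear (fun a => sub_op (upd v i a)).
Proof.
move=> c a b; apply: val_inj; rewrite /= !comp_upd.
exact: op_multilinear.
Qed.

Lemma sub_op_one h i a : sub_op (upd (fun=> sub_one h) i a) = a.
Proof. by apply: val_inj; rewrite /= comp_upd; apply: op_one. Qed.

Definition sub_malg : malg k m u := MAlg sub_op_multilinear sub_op_one.

Lemma sub_val_hom : hom (sub_val : sub_malg -> A).
Proof. by []. Qed.

End SubalgebraMalg.

Lemma hom_teval A B (f : A -> B) : hom f ->
  forall e t, f (teval e t) = teval (f \o e) t.
Proof.
move=> [/linear_bundle[g ->] fop fone] e.
elim=> //= [|s IHs t IHt|c t IHt|ts IH].
- exact: linear0.
- by rewrite linearD IHs IHt.
- by rewrite linearZ IHt.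
- by rewrite fop; congr op; apply: funext => i; apply: IH.
Qed.

Lemma hom_comp A B (C : malg k m u) (f : A -> B) (g : B -> C) :
  hom f -> hom g -> hom (g \o f).
Proof.
move=> [lf fop fone] [lg gop gone]; split=> [c a b|v|h] /=.
- by rewrite lf lg.
- by rewrite fop gop.
- by rewrite fone gone.
Qed.

(** A subalgebra containing the [x i] inherits the identities, so freeness gives a homomorphism from
    [A] into it. Composed with the inclusion it fixes the [x i], hence is the identity by
    uniqueness. *)
Lemma free_generates Id A n (x : 'I_n -> A) : free_in_variety Id x -> generates x.
Proof.
move=> [VA univ] P sP Px a.
have VS : in_variety Id (sub_malg sP).
  by move=> t It e; apply: val_inj; rewrite /= (hom_teval (sub_val_hom sP)) VA.
have xS i : x i \in sub_pred sP by apply/asboolP.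
have [[f hf fx] _] := univ _ VS (fun i => MkSub (xS i)).
have hid : hom (@id A) by [].
have [_ uniq] := univ _ VA x.
rewrite -[a](uniq _ _ (hom_comp hf (sub_val_hom sP)) hid) //; first exact: sub_valP.
by move=> i /=; rewrite fx.
Qed.

End Subalgebra.

(** * Derivations along a homomorphism, and their values on generators *)

Section HomDerivation.
Variables (k : fieldType) (m : nat) (u : bool).
Hypotheses (char0 : [pchar k] =i pred0) (m_ge2 : (2 <= m)%N).
Implicit Types A B : malg k m u.

(** Both [phi \o D] and [E \o phi] are of this kind, which makes them comparable on generators;
    [phi = id] gives ordinary derivations. *)
Definition hom_derivation A B (phi d : A -> B) : Prop :=
  linear d /\
  forall v : 'I_m -> A, d (op v) = \sum_(i < m) op (upd (phi \o v) i (d (v i))).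


(** The Leibniz rule at the product of [m] units reads [d 1 = m d 1], and [m] differs from 1 in
    characteristic zero. *)
Lemma hom_derivation_one A B (phi d : A -> B) (h : u) :
  hom phi -> hom_derivation phi d -> d (one A h) = 0.
Proof.
move=> [_ _ phi1] [_ dop].
have op1 (C : malg k m u) (i : 'I_m) (c : C) :
    op (upd (fun=> one C h) i c) = c by apply: op_one.
have := dop (fun=> one A h).
rewrite -{1}(upd_id (fun=> one A h) (Ordinal m_ge2)) op1.
rewrite (eq_bigr (fun=> d (one A h))) => [|i _]; last first.
  by rewrite -[RHS](op1 _ i); congr op; apply: funext => j; rewrite /= phi1.
rewrite sumr_const card_ord -scaler_nat -{1}[d _]scale1r => /eqP.
rewrite -subr_eq0 -scalerBl scaler_eq0 subr_eq0 => /orP[|/eqP//].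
by rewrite (eqr_nat_pchar0 char0 1) ltn_eqF.
Qed.

(** The set where [d] and [e] agree is a subalgebra; it contains the unit because both vanish
    there. *)
Lemma hom_derivation_ext A B n (x : 'I_n -> A) (phi d e : A -> B) :
  generates x -> hom phi -> hom_derivation phi d -> hom_derivation phi e ->
  (forall i, d (x i) = e (x i)) -> d =1 e.
Proof.
move=> gx hphi dd de dex; apply: gx => //.
have [ld dop] := dd; have [le eop] := de.
split=> [|c a b da db|v dv|h].
- by have [d' ->] := linear_bundle ld; have [e' ->] := linear_bundle le; rewrite !linear0.
- by rewrite ld le da db.
- by rewrite dop eop; apply: eq_bigr => i _; rewrite dv.
- by rewrite !(@hom_derivation_one _ _ phi).
Qed.

Lemma hom_id A : hom (@id A).
Proof. by []. Qed.

Lemma derP A (D : Der A) : derivation D.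
Proof. by case: D => D /= /asboolP. Qed.

Lemma derivation_bundle A (D : A -> A) :
  derivation D -> exists E : Der A, forall a, E a = D a.
Proof.
move=> derD; have DP : D \in derivation_pred (A := A) by apply/asboolP.
by exists (MkDer DP).
Qed.

Lemma hom_derivation_compl A B (phi : A -> B) (D : Der A) :
  hom phi -> hom_derivation phi (phi \o D).
Proof.
move=> [/linear_bundle[f ->] fop _]; have [lD Dop] := derP D.
split=> [c a b|v]; first by rewrite /= lD linearP.
by rewrite /= Dop linear_sum; apply: eq_bigr => i _; rewrite fop comp_upd.
Qed.

Lemma hom_derivation_compr A B (phi : A -> B) (D : Der B) :
  hom phi -> hom_derivation phi (D \o phi).
Proof.
move=> [lphi fop _]; have [lD Dop] := derP D.
split=> [c a b|v]; first by rewrite /= lphi lD.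
by rewrite /= fop Dop.
Qed.

Definition der_extends A n (x : 'I_n -> A) : Prop :=
  forall F : 'I_n -> A, exists D : Der A, forall i, D (x i) = F i.

(* The endomorphisms x_i |-> x_i + l F_i depend polynomially on l, and their
   derivative at l = 0 is the wanted derivation. *)
Lemma free_der_extends Id A n (x : 'I_n -> A) :
  free_in_variety Id x -> der_extends x.
Proof.
move=> fx F; have [VA univ] := fx.
have /choice[phi phiP] : forall l : k, exists f : A -> A,
    hom f /\ forall i, f (x i) = x i + l *: F i.
  move=> l; have [[f hf fE] _] := univ _ VA (fun i => x i + l *: F i).
  by exists f.
(* The elements [a] for which [phi l a] has a jet with value [a] form a subalgebra containing the
   generators. *)
have jet1 a : exists b, jet (phi^~ a) a b.
  move: a; apply: (free_generates fx) => [|i]; last first.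
    exists (F i), (fun=> 0) => [|l]; first exact: PolyfunC.
    by rewrite (phiP l).2 scaler0 addr0.
  split=> [|c a b [a' ja] [b' jb]|v /choice[v' jv]|h].
  - exists 0; apply: (@jet_ext k A (fun=> 0)) => [l|]; last exact: jetC.
    by have [[/linear_bundle[f ->] _ _] _] := phiP l; rewrite linear0.
  - exists (c *: a' + b'); apply: jet_ext (jetD (jetZ c ja) jb) => l.
    by have [[/linear_bundle[f ->] _ _] _] := phiP l; rewrite linearP.
  - exists (\sum_(i < m) op (upd v i (v' i))); apply: jet_ext (jet_op jv) => l.
    by have [[_ -> _] _] := phiP l.
  - exists 0; apply: (@jet_ext k A (fun=> one A h)) => [l|]; last exact: jetC.
    by have [[_ _ ->] _] := phiP l.
have [D jD] := choice jet1.
(* Uniqueness of jets turns each rule for computing jets into a rule for [D]. *)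
have DE a b : jet (phi^~ a) a b -> D a = b.
  by move=> jb; have [] := jet_inj char0 (jD a) jb.
have derD : derivation D.
  split=> [c a b|v]; apply: DE.
    apply: jet_ext (jetD (jetZ c (jD a)) (jD b)) => l.
    by have [[/linear_bundle[f ->] _ _] _] := phiP l; rewrite linearP.
  apply: jet_ext (jet_op (fun i => jD (v i))) => l.
  by have [[_ -> _] _] := phiP l.
have [E ED] := derivation_bundle derD.
exists E => i; rewrite ED; apply: DE; exists (fun=> 0) => [|l]; first exact: PolyfunC.
by rewrite (phiP l).2 scaler0 addr0.
Qed.

End HomDerivation.

(** * The product of derivations and its transport along a homomorphism *)

Section LeftSymmetricProduct.
Variables (k : fieldType) (m : nat) (u : bool).
Hypotheses (char0 : [pchar k] =i pred0) (m_ge2 : (2 <= m)%N).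

Section OneAlgebra.
Variables (A : malg k m u) (n : nat) (x : 'I_n -> A).
Hypotheses (gen_x : generates x) (ext_x : der_extends x).

Lemma der_eq (D E : Der A) : (forall i, D (x i) = E (x i)) -> D = E.
Proof.
move=> DE; apply: val_inj; apply: funext.
exact: (hom_derivation_ext char0 m_ge2 gen_x (hom_id A) (derP D) (derP E) DE).
Qed.

(** Since a solution exists, [xget] returns one rather than its default 0. *)
Lemma derFE F i : derF x F (x i) = F i.
Proof. by rewrite /derF; have := xgetPex 0 (ext_x F); apply. Qed.

Lemma der_linearE (c : k) (D E : Der A) a : (c *: D + E) a = c *: D a + E a.
Proof. by []. Qed.

Lemma der_sumE (I : Type) (s : seq I) (D : I -> Der A) a :
  (\sum_(i <- s) D i) a = \sum_(i <- s) D i a.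
Proof. exact: (big_morph (fun E : Der A => E a)). Qed.

(** The sum over [i] reassembles [D] from its coordinates, and only the [j]-th summand of the other
    sum acts on [x j]. All later computations use this formula in place of the double sum. *)
Lemma lsmulE (D E : Der A) j : lsmul x D E (x j) = D (E (x j)).
Proof.
have DE : \sum_(i < n) pder x (D (x i)) i = D.
  apply: der_eq => j'; rewrite der_sumE (bigD1 j') //= derFE /= eqxx.
  by rewrite big1 ?addr0 // => i /negbTE ij; rewrite derFE /= eq_sym ij.
rewrite -[in RHS]DE der_sumE /lsmul der_sumE.
apply: eq_bigr => i _; rewrite der_sumE (bigD1 j) //= derFE /= eqxx.
by rewrite big1 ?addr0 // => j' /negbTE jj'; rewrite derFE /= eq_sym jj'.
Qed.

End OneAlgebra.

Section TwoAlgebras.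
Variables (A B : malg k m u) (n : nat) (x : 'I_n -> A) (y : 'I_n -> B).
Hypotheses (gen_x : generates x) (ext_x : der_extends x).
Hypotheses (gen_y : generates y) (ext_y : der_extends y).
Variable phi : A -> B.
Hypotheses (hom_phi : hom phi) (phi_x : forall i, phi (x i) = y i).

(** Both sides are derivations along [phi] that agree on generators. *)
Lemma hom_intertwine (D : Der A) (E : Der B) :
  (forall i, E (y i) = phi (D (x i))) -> forall a, phi (D a) = E (phi a).
Proof.
move=> DE; apply: (hom_derivation_ext char0 m_ge2 gen_x hom_phi).
- exact: hom_derivation_compl.
- exact: hom_derivation_compr.
- by move=> i /=; rewrite phi_x DE.
Qed.

Lemma hom_surj b : exists a, phi a = b.
Proof.
have [/linear_bundle[f phiE] phi_op phi_one] := hom_phi.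
apply: (gen_y (P := fun b => exists a, phi a = b)) => [|i]; last by exists (x i).
split=> [|c _ _ [a <-] [a' <-]|v /choice[w wE]|h].
- by exists 0; rewrite phiE linear0.
- by exists (c *: a + a'); rewrite phiE linearP.
- by exists (op w); rewrite phi_op; congr op; apply: funext.
- by exists (one A h).
Qed.

(** The isomorphism is conjugation by [phi], described through values on generators. *)
Lemma lsmul_iso : bijective phi -> isomorphic_alg (lsmul x) (lsmul y).
Proof.
move=> [psi psiK phiK]; have [/linear_bundle[phi' phiE] _ _] := hom_phi.
pose f (D : Der A) : Der B := derF y (fun i => phi (D (x i))).
have fE D i : f D (y i) = phi (D (x i)) by rewrite derFE.
exists f; split.
- move=> c D E; apply: (der_eq gen_y) => i.
  by rewrite der_linearE !fE der_linearE phiE linearP.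
- exists (fun E : Der B => derF x (fun i => psi (E (y i)))) => [D|E].
    by apply: (der_eq gen_x) => i; rewrite derFE // fE psiK.
  by apply: (der_eq gen_y) => i; rewrite fE derFE // phiK.
- move=> D E; apply: (der_eq gen_y) => i.
  by rewrite fE !lsmulE // fE -(hom_intertwine (fE D)).
Qed.

(* {D | phi o D = 0} is an ideal because derivations of A descend to B. *)
Lemma simple_hom_bij (b0 : B) : (0 < n)%N -> b0 != 0 ->
  simple_alg (lsmul x) -> bijective phi.
Proof.
move=> n0 b0N [_ simp]; have [/linear_bundle[f phiE] _ _] := hom_phi.
pose I : set (Der A) := [set D : Der A | forall a, phi (D a) = 0]%classic.
have inI (D : Der A) : (forall i, phi (D (x i)) = 0) -> I D.
  move=> Dx a; have D0 i : (0 : Der B) (y i) = phi (D (x i)) by rewrite Dx.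
  by rewrite (hom_intertwine D0).
have idI : ideal (lsmul x) I.
  split=> [a|c D E ID IE a|D E ID].
  - by rewrite phiE linear0.
  - by rewrite der_linearE phiE linearP -phiE ID IE scaler0 addr0.
  - split; apply: inI => i; rewrite lsmulE //.
    (* [G] is the derivation of [B] induced by [E], so [phi (E (D (x i))) = G (phi (D (x i))) = G
       0]. *)
    pose G := derF y (fun j => phi (E (x j))).
    rewrite (@hom_intertwine E G) => [|j]; last by rewrite derFE.
    by rewrite ID; have [/linear_bundle[g ->] _] := derP G; rewrite linear0.
have [I0|IT] := simp I idI; last first.
  (* The ideal is proper: the derivation sending every [x i] to a preimage of [b0] is not in it. *)
  have [a aE] := hom_surj b0.
  have : I (derF x (fun=> a)) by rewrite IT.
  by move=> /(_ (x (Ordinal n0))); rewrite derFE // aE => /eqP; rewrite (negbTE b0N).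
have ker0 a : phi a = 0 -> a = 0.
  (* For [a] in the kernel, the derivation sending every [x i] to [a] lies in the zero ideal. *)
  move=> a0; have : I (derF x (fun=> a)) by apply: inI => i; rewrite derFE.
  rewrite I0 => /= D0; rewrite -(derFE ext_x (fun=> a) (Ordinal n0)) D0.
  by [].
have inj : injective phi.
  move=> a a' aa'; apply/eqP; rewrite -subr_eq0; apply/eqP/ker0.
  by rewrite phiE linearB -phiE aa' subrr.
have [psi psiE] := choice hom_surj.
by exists psi => [a|]; first apply: inj.
Qed.

End TwoAlgebras.
End LeftSymmetricProduct.

(** * Isomorphism and simplicity of abstract algebras *)

Section AbstractAlgebras.
Variable k : fieldType.
Implicit Types L : lmodType k.

Lemma isomorphic_alg_trans L1 L2 (L3 : lmodType k) (mul1 : L1 -> L1 -> L1)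
    (mul2 : L2 -> L2 -> L2) (mul3 : L3 -> L3 -> L3) :
  isomorphic_alg mul1 mul2 -> isomorphic_alg mul2 mul3 -> isomorphic_alg mul1 mul3.
Proof.
move=> [f [lf bf fM]] [g [lg bg gM]]; exists (g \o f); split.
- by move=> c a b /=; rewrite lf lg.
- exact: bij_comp.
- by move=> a b /=; rewrite fM gM.
Qed.

Lemma isomorphic_simple L1 L2 (mul1 : L1 -> L1 -> L1) (mul2 : L2 -> L2 -> L2) :
  isomorphic_alg mul1 mul2 -> simple_alg mul2 -> simple_alg mul1.
Proof.
move=> [_ [/linear_bundle[f ->] [g fK gK] fM]] [[a [b ab]] simp].
split=> [|I [I0 IL IM]].
  exists (g a), (g b); apply: contra_neq ab => ab.
  by rewrite -[mul2 a b]gK -[a]gK -[b]gK -fM gK ab linear0.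
have idJ : ideal mul2 [set y | I (g y)]%classic.
  split=> /= [|c y z Iy Iz|y z Iy].
  - by rewrite (_ : g 0 = 0) // -[0 in LHS](linear0 f) fK.
  - by rewrite (_ : g _ = c *: g y + g z); [apply: IL|rewrite -[RHS]fK linearP !gK].
  - have gM t s : g (mul2 t s) = mul1 (g t) (g s) by rewrite -[RHS]fK fM !gK.
    by rewrite !gM; apply: IM.
have IE a' : I a' <-> [set y | I (g y)]%classic (f a') by rewrite /= fK.
have [J0|JT] := simp _ idJ; [left|right]; apply/seteqP; split=> y //=.
- by move/IE; rewrite J0 /= => fy; rewrite -[y]fK fy -(linear0 f) fK.
- by move->.
- by move=> _; apply/IE; rewrite JT.
Qed.

End AbstractAlgebras.

(** * The polynomial algebra and simplicity of the Witt algebra *)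

Section Polynomials.
Variables (k : fieldType) (n : nat).
Hypothesis char0 : [pchar k] =i pred0.

Notation W := (mpoly_malg k n).
Notation X := (@mpoly_var k n).

(* The substitution c_i |-> 2 c_i separates two monomials that differ at i. *)
Lemma sum_monomials_eq0 (s : seq 'X_{1..n}) (a : 'X_{1..n} -> k) : uniq s ->
  (forall c : 'I_n -> k, \sum_(m <- s) a m * \prod_(i < n) c i ^+ m i = 0) ->
  forall m, m \in s -> a m = 0.
Proof.
elim: s a => // m0 s IH a /= /andP[m0s us] a0.
have tl m : m \in s -> a m = 0.
  move=> ms; have [i mi] : exists i, m i != m0 i.
    apply: contrapT => mm0; case/negP: m0s; rewrite (_ : m0 = m) //.
    apply/mnmP => i; apply/eqP; rewrite eq_sym; apply/negPn/negP => ne.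
    by apply: mm0; exists i.
  have : a m * (2%:R ^+ m i - 2%:R ^+ m0 i) = 0.
    apply: (IH (fun m => a m * (2%:R ^+ m i - 2%:R ^+ m0 i))) => // c.
    pose c2 := upd c i (2%:R * c i).
    have c2E m' : \prod_(j < n) c2 j ^+ m' j = 2%:R ^+ m' i * \prod_(j < n) c j ^+ m' j.
      rewrite (bigD1 i) //= {1}/c2 /= eqxx exprMn -mulrA [in RHS](bigD1 i) //=.
      by congr (_ * (_ * _)); apply: eq_bigr => j /negbTE ji; rewrite /c2 /= ji.
    (* Subtracting [2 ^ (m0 i)] times the relation at [c] from the one at [c2] cancels the [m0]
       term. *)
    have := congr2 (fun x y => x - 2%:R ^+ m0 i * y) (a0 c2) (a0 c).
    rewrite /= mulr0 subr0 !big_cons c2E mulrDr opprD addrACA.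
    rewrite [a m0 * _]mulrCA subrr add0r mulr_sumr -sumrB => e; rewrite -[RHS]e.
    by apply: eq_bigr => m' _; rewrite c2E mulrBr mulrBl !mulrA !(mulrC (a m')).
  move/eqP; rewrite mulf_eq0 subr_eq0 => /orP[/eqP//|].
  by rewrite -!natrX eqr_nat_pchar0 // eqn_exp2l // (negbTE mi).
move=> m; rewrite inE => /orP[/eqP->|]; last exact: tl.
have := a0 (fun=> 1); rewrite big_cons [X in _ + X]big_seq.
rewrite [X in _ + X]big1 => [|m' /tl ->]; last by rewrite mul0r.
by rewrite addr0 big1 ?mulr1 // => i _; rewrite expr1n.
Qed.

Lemma mpoly_vanish (p : {mpoly k[n]}) : (forall c, p.@[c] = 0) -> p = 0.
Proof.
move=> p0; apply/mpolyP => m; rewrite mcoeff0.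
have [ms|] := boolP (m \in msupp p); last by rewrite -mcoeff_eq0 => /eqP.
apply: (@sum_monomials_eq0 (msupp p) (fun m => p@_m)) ms => // c.
Qed.

Lemma mpoly_generates : generates X.
Proof.
move=> P [P0 PD Pop P1] PX.
have PM (p q : W) : P p -> P q -> P ((p : {mpoly k[n]}) * q).
  move=> Pp Pq; have := Pop (fun i => if i == ord0 then p else q).
  by apply=> i; case: ifP.
apply: mpolyind => // c m p _ _; apply: PD.
rewrite mpolyXE_id; apply: (big_ind P) => [|p' q'|i _].
- exact: (P1 isT).
- exact: PM.
- elim: (m i) => [|e IH]; first exact: (P1 isT).
  by rewrite exprS; apply: PM (PX i) IH.
Qed.

Lemma mpoly_derivation (F : 'I_n -> {mpoly k[n]}) :
  derivation (fun p : W => \sum_(i < n) F i * mderiv i p : W).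
Proof.
split=> [c p q|v].
  rewrite scaler_sumr -big_split; apply: eq_bigr => i _ /=.
  by rewrite linearP mulrDr scalerAr.
rewrite big_ord_recl big_ord1 /= /mpoly_op /=.
rewrite (_ : lift ord0 ord0 = ord_max); last exact: val_inj.
rewrite mulr_suml mulr_sumr -big_split; apply: eq_bigr => i _ /=.
by rewrite mderivM mulrDr [in RHS]mulrCA -[in RHS]mulrA.
Qed.

Lemma sum_mderivX (F : 'I_n -> {mpoly k[n]}) i :
  \sum_(j < n) F j * mderiv j 'X_i = F i.
Proof.
rewrite (bigD1 i) //= big1 => [|j ji].
  rewrite mderivX mnm1E eqxx scale1r addr0 (_ : (U_(i) - U_(i))%MM = 0%MM).
    by rewrite mpolyX0 mulr1.
  by apply/mnmP => j; rewrite mnmBE subnn mnm0E.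
by rewrite mderivX mnm1E eq_sym (negbTE ji) scale0r mulr0.
Qed.

Lemma mpoly_der_extends : der_extends X.
Proof.
move=> F; have [D DE] := derivation_bundle (mpoly_derivation F).
by exists D => i; rewrite DE sum_mderivX.
Qed.

Lemma mpoly_derE (D : Der W) (p : {mpoly k[n]}) :
  D p = \sum_(i < n) (D (X i) : {mpoly k[n]}) * mderiv i p.
Proof.
have [E EE] := derivation_bundle (mpoly_derivation (fun i => D (X i))).
suff DE : D = E by rewrite {1}DE EE.
by apply: (der_eq char0 (leqnn 2) mpoly_generates) => i; rewrite EE sum_mderivX.
Qed.

Lemma mpoly_pderE (a : {mpoly k[n]}) l (p : {mpoly k[n]}) :
  pder X a l p = a * mderiv l p.
Proof.
have derE := derFE mpoly_der_extends.
rewrite mpoly_derE (bigD1 l) //= big1 => [|i /negbTE il]; rewrite derE /=.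
  by rewrite eqxx addr0.
by rewrite il mul0r.
Qed.

(** Monomials are integrated in the variable [i], dividing by the new exponent. *)
Lemma mderiv_surj (i : 'I_n) (p : {mpoly k[n]}) : exists q, mderiv i q = p.
Proof.
elim/mpolyind: p => [|c m p _ _ [q qE]]; first by exists 0; rewrite mderiv0.
exists ((c / (m i).+1%:R) *: 'X_[m + U_(i)] + q).
rewrite mderivD mderivZ mderivX qE mnmDE mnm1E eqxx addn1 addmK scalerA.
by rewrite divfK // (pcharf0P _).1.
Qed.

Lemma mcoeff_mderiv0 (p : {mpoly k[n]}) i : mderiv i p = 0 ->
  forall m : 'X_{1..n}, m i != 0%N -> p@_m = 0.
Proof.
move=> p0 m mi.
have le : (U_(i) <= m)%MM.
  by apply/mnm_lepP => j; rewrite mnm1E; case: eqP => // <-; rewrite lt0n.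
have := mcoeff_deriv i (m - U_(i))%MM p.
rewrite p0 mcoeff0 submK // => /esym/eqP.
by rewrite -mulr_natr mulf_eq0 (pcharf0P _).1 // orbF => /eqP.
Qed.

(** Left multiplication by partial derivatives lowers a nonzero element of an ideal to one with
    constant coefficients. From it the ideal obtains a single partial derivative, which generates
    everything. *)
Lemma witt_simple : (0 < n)%N -> simple_alg (@witt_mul k n).
Proof.
move=> n0; pose i0 := Ordinal n0.
have genX := mpoly_generates; have extX := mpoly_der_extends.
have mulE : forall D E j, witt_mul D E (X j) = D (E (X j))
  := lsmulE char0 (leqnn 2) genX extX.
have derE := derFE extX.
split.
  (* The Euler derivation is a nonzero idempotent. *)
  exists (derF X X), (derF X X); apply/eqP => /(congr1 (fun D : Der W => D (X i0))).
  rewrite mulE !derE => /eqP; rewrite -msupp_eq0 /mpoly_var msuppX //.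
move=> I [I0 IL IM].
have [[D [ID D0]]|all0] := pselect (exists D, I D /\ D <> 0); [right|left]; last first.
  apply/seteqP; split=> D /=; last by move->.
  by move=> ID; apply: contrapT => D0; apply: all0; exists D.
suff I1 : I (pder X 1 i0).
  apply/seteqP; split=> // G _.
  (* Antiderivatives of the coefficients of [G] exhibit it as a product with left factor
     [pder X 1 i0]. *)
  have /choice[E EE] := fun i => mderiv_surj i0 (G (X i)).
  rewrite (_ : G = witt_mul (pder X 1 i0) (derF X E)).
    by have [] := IM _ (derF X E) I1.
  apply: (der_eq char0 (leqnn 2) genX) => i.
  by rewrite mulE mpoly_pderE derE mul1r EE.
have nz (E : Der W) : E <> 0 -> exists j, E (X j) <> 0.
  move=> E0; apply: contrapT => noj; apply: E0; apply: (der_eq char0 (leqnn 2) genX) => j.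
  by apply: contrapT => ne; apply: noj; exists j.
(* Descent on a strict bound [d] for the degrees of the coefficients of [E]. *)
suff red d : forall E : Der W, I E -> E <> 0 ->
    (forall i m, (d <= mdeg m)%N -> (E (X i) : {mpoly k[n]})@_m = 0) -> I (pder X 1 i0).
  apply: (red (\max_(i < n) msize (D (X i) : {mpoly k[n]})) D ID D0) => i m lem.
  apply/eqP; rewrite mcoeff_eq0; apply: msize_mdeg_ge; apply: leq_trans lem.
  exact: (leq_bigmax i).
elim: d => [|d IH] E IE E0 Ed.
  by have [j []] := nz _ E0; apply/mpolyP => m; rewrite mcoeff0 Ed.
have [[l [i li]]|const] := pselect (exists l i, mderiv l (E (X i)) <> 0).
  have dE j : witt_mul (pder X 1 l) E (X j) = mderiv l (E (X j)).
    by rewrite mulE mpoly_pderE mul1r.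
  apply: (IH (witt_mul (pder X 1 l) E)).
  - by have [] := IM _ (pder X 1 l) IE.
  - by move=> e; apply: li; rewrite -dE e.
  - move=> j m dm; rewrite dE mcoeff_deriv Ed ?mul0rn //.
    by rewrite mdegD mdeg1 addn1 ltnS.
(* All partial derivatives of the coefficients vanish here, so in characteristic zero the
   coefficients are constants. *)
have [j Ej0] := nz _ E0.
have Ec i : (E (X i) : {mpoly k[n]}) = ((E (X i) : {mpoly k[n]})@_0)%:MP.
  apply/mpolyP => m; rewrite mcoeffC; case: eqP => [->|/eqP m0]; first by rewrite mulr1.
  rewrite mulr0; have [l ml] : exists l, m l != 0%N.
    apply: contrapT => nol; case/eqP: m0; apply/mnmP => l; rewrite mnm0E.
    by apply/eqP/negPn/negP => ml; apply: nol; exists l.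
  apply: (mcoeff_mderiv0 _ ml); apply: contrapT => ne; apply: const.
  by exists l, i.
set c := (E (X j) : {mpoly k[n]})@_0.
have c0 : c != 0 by apply: contra_notN Ej0 => /eqP e; rewrite Ec -/c e mpolyC0.
(* Multiplying [E] by [pder X (X j) i0] on the right gives [c] times [pder X 1 i0]. *)
rewrite (_ : pder X 1 i0 = c^-1 *: witt_mul E (pder X (X j) i0) + 0).
  by apply: IL => //; have [] := IM _ (pder X (X j) i0) IE.
apply: (der_eq char0 (leqnn 2) genX) => l.
rewrite addr0 -[c^-1 *: _]addr0 der_linearE mulE !derE addr0 /=; case: eqP => _.
  by rewrite Ec -/c -mul_mpolyC -mpolyCM mulVf.
have [/linear_bundle[e ->] _] := derP E.
by rewrite linear0 scaler0.
Qed.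

(* Substituting scalars for the variables reduces an identity of k[x] to one of
   the line k 1 inside any nonzero unital algebra of the variety. *)
Lemma mpoly_in_variety (Id : set (mterm k 2 true)) :
  nontrivial_variety Id -> in_variety Id W.
Proof.
move=> [B [VB [b b0]]] t It e; apply: mpoly_vanish => c.
have op1 (i : 'I_2) (a : B) : op (upd (fun=> one B isT) i a) = a by apply: op_one.
have one0 : one B isT != 0.
  (* If the unit were 0, then [b], its product with the unit, would be 0. *)
  apply: contra_neq b0 => one0; rewrite -(op1 ord0 b).
  pose v : 'I_2 -> B := upd (fun=> one B isT) ord0 b; have v1 : v ord_max = 0 := one0.
  by rewrite -/v -(upd_id v ord_max) v1 op_upd0.
suff tE s : teval (fun i => (e i : {mpoly k[n]}).@[c] *: one B isT) s
    = (teval e s : {mpoly k[n]}).@[c] *: one B isT.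
  by have /esym/eqP := tE t; rewrite VB // scaler_eq0 (negbTE one0) orbF => /eqP.
elim: s => //= [|s1 IH1 s2 IH2|a s IH|ts IH|h].
- by rewrite meval0 scale0r.
- by rewrite IH1 IH2 mevalD scalerDl.
- by rewrite IH mevalZ scalerA.
- rewrite /mpoly_op mevalM.
  set p := teval e (ts ord0); set q := teval e (ts ord_max).
  pose v : 'I_2 -> B := fun=> one B isT.
  have -> : (fun i => teval (fun j => (e j).@[c] *: one B isT) (ts i))
      = upd (upd v ord0 (p.@[c] *: one B isT)) ord_max (q.@[c] *: one B isT).
    apply: funext => i /=; rewrite IH.
    case: eqP => [->//|/eqP im]; case: eqP => [->//|/eqP i0].
    by case: i im i0 => [[|[|]]].
  rewrite op_updZ updC // op_updZ (upd_id v ord_max) op1.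
  by rewrite scalerA mulrC.
- by rewrite meval1 scale1r; congr one; apply: bool_irrelevance.
Qed.

End Polynomials.

(** * The algebra with zero product and the matrix algebra *)

Section ZeroAlgebra.
Variables (k : fieldType) (m n : nat).
Hypotheses (char0 : [pchar k] =i pred0) (m_ge2 : (2 <= m)%N).

Definition zero_op (v : 'I_m -> 'cV[k]_n) : 'cV[k]_n := 0.

Lemma zero_op_multilinear (i : 'I_m) (v : 'I_m -> 'cV[k]_n) :
  linear (fun a => zero_op (upd v i a)).
Proof. by move=> c a b; rewrite /zero_op scaler0 addr0. Qed.

Lemma zero_op_one (h : false) (i : 'I_m) (a : 'cV[k]_n) :
  zero_op (upd (fun=> 0) i a) = a.
Proof. by []. Qed.

Definition zero_malg : malg k m false :=
  @MAlg k m false 'cV[k]_n zero_op zero_op_multilinear (fun=> 0) zero_op_one.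

Definition zero_var (i : 'I_n) : zero_malg := delta_mx i 0.

Lemma zero_generates : generates zero_var.
Proof.
move=> P [P0 PD _ _] Px a; rewrite (matrix_sum_delta a).
have PE : forall (a b : zero_malg), P a -> P b -> P (a + b).
  by move=> b c Pb Pc; have := PD 1 _ _ Pb Pc; rewrite scale1r.
apply: (big_ind P) => // i _; rewrite big_ord1.
by have := PD (a i 0) _ _ (Px i) P0; rewrite addr0.
Qed.

Lemma zero_derivation (M : 'M[k]_n) : derivation (mulmx M : zero_malg -> zero_malg).
Proof.
split=> [c a b|v]; first by rewrite mulmxDr scalemxAr.
by rewrite mulmx0 big1.
Qed.

Lemma zero_der_extends : der_extends zero_var.
Proof.
move=> F; have [D DE] := derivation_bundle (zero_derivation (\matrix_(p, i) F i p 0)).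
exists D => i; rewrite DE /zero_var -colE; apply/matrixP => p q.
by rewrite !mxE ord1.
Qed.

(** Every linear map is a derivation here, and the product becomes composition. Column [i] of [f D]
    is the image of the [i]-th basis vector. *)
Lemma zero_lsmul_iso : isomorphic_alg (lsmul zero_var) (@mulmx k n n n).
Proof.
have [gen ext] := (zero_generates, zero_der_extends).
pose f (D : Der zero_malg) : 'M[k]_n := \matrix_(p, i) (D (zero_var i) : 'cV[k]_n) p 0.
have DE (D : Der zero_malg) a : D a = f D *m (a : 'cV[k]_n).
  have [E EE] := derivation_bundle (zero_derivation (f D)).
  suff DE : D = E by rewrite {1}DE EE.
  apply: (der_eq char0 m_ge2 gen) => i; rewrite EE /zero_var -colE.
  by apply/matrixP => p q; rewrite !mxE ord1.
exists f; split.
- by move=> c D E; apply/matrixP => p i; rewrite !mxE.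
- exists (fun M : 'M[k]_n => derF zero_var (fun i => col i M)) => [D|M].
    apply: (der_eq char0 m_ge2 gen) => i.
    by rewrite derFE // DE /zero_var -colE.
  by apply/matrixP => p i; rewrite mxE derFE // mxE.
- move=> D E; apply/matrixP => p i; rewrite mxE lsmulE // DE mxE [RHS]mxE.
  by apply: eq_bigr => q _; rewrite [f E q i]mxE.
Qed.

(* Evaluating an identity at l e_i b, its part linear in l is its value in the
   algebra with zero product. *)
Lemma zero_in_variety (Id : set (mterm k m false)) :
  nontrivial_variety Id -> in_variety Id zero_malg.
Proof.
move=> [B [VB [b b0]]] t It e; apply/matrixP => p q; rewrite ord1 mxE {q}.
have i0 : 'I_m := Ordinal m_ge2.
have op0 : op (fun=> 0 : B) = 0 by rewrite -(upd_id (fun=> 0 : B) i0) op_upd0.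
have op00 i (a : B) : op (upd (fun=> 0) i a) = 0.
  (* Index 1 serves as [j], or index 0 when [i] is 1. *)
  have [j ji] : exists j : 'I_m, j != i.
    have [i_0|] := eqVneq (Ordinal m_ge2) i; last by exists (Ordinal m_ge2).
    by exists (Ordinal (ltnW m_ge2)); rewrite -i_0.
  pose v := upd (fun=> 0 : B) i a; have v0 : v j = 0 by rewrite /v /= (negbTE ji).
  by rewrite -/v -(upd_id v j) v0 op_upd0.
suff tJ s : jet (fun l => teval (fun i => l *: ((e i : 'cV[k]_n) p 0 *: b)) s) 0
    ((teval e s : 'cV[k]_n) p 0 *: b).
  have [l|_ /eqP] := jet0_inj char0 (tJ t); first exact: VB.
  by rewrite scaler_eq0 (negbTE b0) orbF => /eqP.
elim: s => [i||s1 IH1 s2 IH2|c s IH|ts IH|//] /=.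
- exact/jetX/jetC.
- by rewrite mxE scale0r; apply: jetC.
- by rewrite mxE scalerDl -[X in jet _ X _]addr0; apply: jetD.
- by rewrite mxE -scalerA -[X in jet _ X _](scaler0 _ c); apply: jetZ.
- have := jet_op IH; rewrite op0 big1 => [|i _]; last exact: op00.
  by rewrite mxE scale0r.
Qed.

End ZeroAlgebra.

(** Sandwiching [A] between matrix units isolates one nonzero entry [A p q] at any chosen
    position. *)
Lemma matrix_simple (k : fieldType) n : (0 < n)%N -> simple_alg (@mulmx k n n n).
Proof.
move=> n0; pose i0 := Ordinal n0; split.
  exists 1%:M, 1%:M; rewrite mul1mx; apply/eqP => /matrixP/(_ i0 i0)/eqP.
  by rewrite !mxE eqxx oner_eq0.
move=> I [I0 IL IM].
have [[A [IA A0]]|all0] := pselect (exists A, I A /\ A <> 0); [right|left]; last first.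
  apply/seteqP; split=> A /=; last by move->.
  by move=> IA; apply: contrapT => A0; apply: all0; exists A.
have [p [q Apq]] : exists p q, A p q != 0.
  apply: contrapT => no; apply: A0; apply/matrixP => p q; rewrite mxE.
  by apply/eqP/negPn/negP => ne; apply: no; exists p, q.
have ID c i j : I (c *: delta_mx i j).
  have -> : c *: delta_mx i j
      = (c / A p q) *: (delta_mx i p *m A *m delta_mx q j) + 0.
    rewrite addr0; apply/matrixP => r s; rewrite !mxE.
    rewrite (bigD1 q) //= big1 => [|t /negbTE tq]; last by rewrite !mxE tq mulr0.
    rewrite !mxE eqxx (bigD1 p) //= big1 => [|t /negbTE tp].
      by rewrite !mxE eqxx !addr0 andbT /=; case: (r == i) (s == j) => [] [];
        rewrite ?(mulr0, mulr1, mul0r, mul1r) ?divfK.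
    by rewrite !mxE tp andbF mul0r.
  apply: IL => //; have [_ IpA] := IM _ (delta_mx i p) IA.
  by have [] := IM _ (delta_mx q j) IpA.
have IS (a b : 'M[k]_n) : I a -> I b -> I (a + b).
  by move=> Ia Ib; have := IL 1 _ _ Ia Ib; rewrite scale1r.
apply/seteqP; split=> // M _; rewrite (matrix_sum_delta M).
by do 2!(apply: (big_ind I) => // ? _).
Qed.

Theorem proposition1 (k : fieldType) (hk : [pchar k] =i pred0)
    (m : nat) (hm : (2 <= m)%N) (u : bool) (hu : u -> m = 2%N)
    (Id : set (mterm k m u)) (hId : nontrivial_variety Id)
    (n : nat) (hn : (0 < n)%N)
    (A : malg k m u) (x : 'I_n -> A) (hA : free_in_variety Id x) :
  simple_alg (lsmul x) <->
  (isomorphic_alg (lsmul x) (@witt_mul k n) \/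
   isomorphic_alg (lsmul x) (@mulmx k n n n)).
Proof.
split=> [simpA|[|] iso]; last first.
- exact: isomorphic_simple iso (matrix_simple k hn).
- exact: isomorphic_simple iso (witt_simple hk hn).
have genA := free_generates hA; have extA := free_der_extends hk hA.
have [VA univ] := hA.
(* The flag [u] selects the comparison algebra, and with it the alternative that is proved. *)
case: u hu Id hId A x hA simpA genA extA VA univ
  => hu Id hId A x hA simpA genA extA VA univ.
  have m2 := hu isT; subst m; left.
  have [[phi hphi phix] _] := univ _ (mpoly_in_variety hk hId) (@mpoly_var k n).
  have genW := @mpoly_generates k n; have extW := @mpoly_der_extends k n.
  apply: (lsmul_iso hk hm genA extA genW extW hphi phix).
  exact: (simple_hom_bij hk hm genA extA genW extW hphi phix hn (oner_neq0 _) simpA).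
right.
have [[phi hphi phix] _] := univ _ (zero_in_variety hk hm hId) (@zero_var k m n).
have genZ := @zero_generates k m n; have extZ := @zero_der_extends k m n.
apply: isomorphic_alg_trans (zero_lsmul_iso n hk hm).
apply: (lsmul_iso hk hm genA extA genZ extZ hphi phix).
have e0 : zero_var k m (Ordinal hn) != 0.
  by apply/eqP => /matrixP/(_ (Ordinal hn) 0)/eqP; rewrite !mxE !eqxx oner_eq0.
exact: (simple_hom_bij hk hm genA extA genZ extZ hphi phix hn e0 simpA).
Qed.
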